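(* Let $p>3$ be a prime. Then $$\sum_{k=0}^{p-1}\frac{\binom{2k}{k}\binom{3k}{k}}{24^k}\equiv\begin{cases}\binom{(2p-2)/3}{(p-1)/3}\pmod{p^2} & \text{if } p\equiv 1\pmod 3,\\[2mm] p\Big/\binom{(2p+2)/3}{(p+1)/3}\pmod{p^2} & \text{if } p\equiv 2\pmod 3.\end{cases}$$
   Context: Congruences modulo $p^2$ between rational numbers whose denominators are prime to $p$ are understood in the ring $\mathbb{Z}_p$ of $p$-adic integers (equivalently, in the localization $\mathbb{Z}_{(p)}$). *)

(* Defs.v *)
From mathcomp Require Import all_boot all_order all_algebra.

Set Implicit Arguments.
Unset Strict Implicit.
Unset Printing Implicit Defensive.

Import GRing.Theory.

Local Open Scope ring_scope.

(* The localization Z_(p), as a subset of the rationals; denq x is the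
   (positive) denominator of x in lowest terms. *)
Definition Zloc (p : nat) : {pred rat} := [pred x : rat | coprime p `|denq x|%N].

(* Congruence modulo m in the ring Z_(p): both sides lie in Z_(p) and their
   difference lies in the ideal generated by m. *)
Definition eqmod_Zloc (p m : nat) (x y : rat) : Prop :=
  [/\ x \in Zloc p, y \in Zloc p & exists2 r : rat, r \in Zloc p & x - y = m%:R * r].

(* Main.v *)
Require Import Defs.
From HB Require Import structures.
From mathcomp Require Import all_boot all_order all_algebra ring lra zify.

(* The k-th summand is the k-th term of 2F1(1/3, 2/3; 1; 9/8). Deform it to
   2F1(1/3 - t, 2/3 - t; 1 - 3t; 9/8) with t = u p / 3. For k < p each term is
   p-integral and, modulo p^2, affine in u, so the truncated sums T(u) satisfy
   T(0) = 2 T(1) - T(2) modulo p^2. For u = 1 and u = 2 the series terminates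
   before p, and a WZ argument evaluates it as a quotient of rising factorials.
   Each of those starts at some p y - b, hence is a factorial quotient times a
   product of factors 1 - p y / i. If p = 1 modulo 3 the first-order terms cancel thanks to
   H_{p-1-k} = H_k and H_{3h} + H_{2h} = H_h modulo p = 6h + 1, where H denotes
   harmonic numbers; if p = 2 modulo 3, then T(1) and T(2) are 2 and 3 times the
   right-hand side modulo p^2. *)

Set Implicit Arguments.
Unset Strict Implicit.

Import Order.TTheory GRing.Theory Num.Theory.
Local Open Scope ring_scope.

(** * The localization as a subring of the rationals, and some of its units *)

(** Any denominator prime to [p] will do, reduced or not, so closure under ring operations only has
    to multiply denominators. From [numq x * d = a * denq x], Gauss's lemma makes the reduced
    denominator divide [d]. *)
Lemma Zloc_divP (p : nat) (x : rat) :
  reflect (exists2 d : nat, coprime p d & x * d%:R \is a Num.int) (x \in Zloc p).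
Proof.
apply: (iffP idP) => [xZ | [d pd /intrP [a xd]]].
  exists `|denq x|%N => //.
  by rewrite natr_absz gtr0_norm ?denq_gt0 // -numqE intr_int.
(* [d = 0] is prime to [p] only when [p = 1], and then every rational lies in [Zloc p]. *)
have [d0|d_gt0] := posnP d.
  by move: pd; rewrite d0 /coprime gcdn0 inE => /eqP ->; rewrite coprime1n.
suff dd : (`|denq x| %| d)%N by rewrite inE (coprime_dvdr dd).
have e : numq x * d%:Z = a * denq x.
  apply/eqP; rewrite -(eqr_int rat) !rmorphM /= numqE -xd.
  by apply/eqP; rewrite mulrAC -pmulrn.
rewrite -(@Gauss_dvdr _ `|numq x|) 1?coprime_sym ?coprime_num_den //.
by apply/dvdnP; exists `|a|%N; rewrite -abszM -e abszM.
Qed.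

Fact Zloc_subring_closed (p : nat) : subring_closed (Zloc p).
Proof.
split=> [|x y|x y].
- by apply/Zloc_divP; exists 1%N; rewrite ?coprimen1 ?mulr1.
- move=> /Zloc_divP [d pd xd] /Zloc_divP [e pe ye].
  apply/Zloc_divP; exists (d * e)%N; first by rewrite coprimeMr pd.
  have -> : (x - y) * (d * e)%:R = x * d%:R * e%:R - y * e%:R * d%:R by ring.
  by apply: rpredB; apply: rpredM => //; apply: rpred_nat.
- move=> /Zloc_divP [d pd xd] /Zloc_divP [e pe ye].
  apply/Zloc_divP; exists (d * e)%N; first by rewrite coprimeMr pd.
  have -> : x * y * (d * e)%:R = x * d%:R * (y * e%:R) by ring.
  exact: rpredM.
Qed.

HB.instance Definition _ (p : nat) :=
  GRing.isSubringClosed.Build rat (Zloc p) (Zloc_subring_closed p).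

Lemma Zloc_intV (p : nat) (m : int) : coprime p `|m| -> m%:~R^-1 \in Zloc p.
Proof.
move=> pm; apply/Zloc_divP; exists `|m|%N => //.
have [-> | m0] := eqVneq m 0; first by rewrite absz0 mulr0.
by rewrite pmulrn abszEsg rmorphM mulrCA mulVf ?intr_eq0 // mulr1 intr_int.
Qed.

Lemma Zloc_natV (p n : nat) : coprime p n -> n%:R^-1 \in Zloc p.
Proof. exact: (@Zloc_intV p n). Qed.

Lemma Zloc_ratio (p m n : nat) : coprime p n -> m%:R / n%:R \in Zloc p.
Proof. by move=> pn; rewrite rpredM ?rpred_nat ?Zloc_natV. Qed.

Lemma coprime_lt_prime (p i : nat) : prime p -> (0 < i < p)%N -> coprime p i.
Proof. by move=> pp /andP [i0 ip]; rewrite prime_coprime // gtnNdvd. Qed.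

Lemma coprime_fact (p n : nat) : prime p -> (n < p)%N -> coprime p n`!.
Proof.
move=> pp; elim: n => [_ | n IHn np]; first exact: coprimen1.
by rewrite factS coprimeMr (@coprime_lt_prime p n.+1) ?IHn // ltnW.
Qed.

Lemma coprime_addMz (p d : nat) (a : int) :
  coprime p d -> coprime p `|d%:Z + p%:Z * a|.
Proof.
by rewrite -[p in coprime p `|_|]absz_nat -coprimezE /coprimez addrC mulrC gcdzMDl.
Qed.

(** With [s = a / d] the number is [(d + p a) / d]; its numerator is prime to [p], hence nonzero
    because [p > 1]. *)
Lemma Zloc_one_addV (p : nat) (s : rat) : (1 < p)%N -> s \in Zloc p ->
  1 + p%:R * s != 0 /\ (1 + p%:R * s)^-1 \in Zloc p.
Proof.
move=> p_gt1 /Zloc_divP [d pd /intrP [a sd]].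
have d0 : d%:R != 0 :> rat.
  by rewrite pnatr_eq0; apply: contraTneq pd => ->; rewrite /coprime gcdn0 gtn_eqF.
have pm : coprime p `|d%:Z + p%:Z * a|.
  exact: coprime_addMz.
have m0 : (d%:Z + p%:Z * a)%:~R != 0 :> rat.
  by rewrite intr_eq0; apply: contraTneq pm => ->; rewrite /coprime absz0 gcdn0 gtn_eqF.
have e : 1 + p%:R * s = (d%:Z + p%:Z * a)%:~R / d%:R.
  by rewrite rmorphD rmorphM /= -sd -!pmulrn; field.
rewrite e invf_div mulf_neq0 ?invr_neq0 //; split=> //.
by rewrite rpredM ?rpred_nat ?Zloc_intV.
Qed.

(** * First-order expansions modulo [p^2]: affine families and logarithms *)

(** The pair [cd] holds the constant term and the slope, common to all [u]; only the error [e]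
    varies. The values [u = 0, 1, 2] are those entering a second difference. *)
Definition affine_modp2 (p : nat) (f : nat -> rat) : Prop :=
  exists2 cd : rat * rat, cd.1 \in Zloc p /\ cd.2 \in Zloc p &
  forall u, (u < 3)%N -> exists2 e, e \in Zloc p &
    f u = cd.1 + p%:R * u%:R * cd.2 + p%:R ^+ 2 * e.

Lemma affine_modp2_eq (p : nat) (c d : rat) : c \in Zloc p -> d \in Zloc p ->
  affine_modp2 p (fun u => c + p%:R * u%:R * d).
Proof.
move=> cZ dZ; exists (c, d) => // u _.
by exists 0; rewrite ?rpred0 // mulr0 addr0.
Qed.

Lemma affine_modp2D (p : nat) (f g : nat -> rat) :
  affine_modp2 p f -> affine_modp2 p g -> affine_modp2 p (fun u => f u + g u).
Proof.
move=> [[c d] /= [cZ dZ] fe] [[c' d'] /= [cZ' dZ'] ge].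
exists (c + c', d + d'); first by rewrite /= !rpredD.
move=> u u3; have [e eZ ->] := fe u u3; have [e' eZ' ->] := ge u u3.
by exists (e + e'); [rewrite rpredD | rewrite /=; ring].
Qed.

(** The slope obeys the product rule; the quadratic term [p^2 u^2 d d'] is absorbed by the error. *)
Lemma affine_modp2M (p : nat) (f g : nat -> rat) :
  affine_modp2 p f -> affine_modp2 p g -> affine_modp2 p (fun u => f u * g u).
Proof.
move=> [[c d] /= [cZ dZ] fe] [[c' d'] /= [cZ' dZ'] ge].
exists (c * c', c * d' + d * c'); first by rewrite /= rpredD ?rpredM.
move=> u u3; have [e eZ ->] := fe u u3; have [e' eZ' ->] := ge u u3.
exists (u%:R ^+ 2 * d * d' + e * (c' + p%:R * u%:R * d' + p%:R ^+ 2 * e') +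
        e' * (c + p%:R * u%:R * d)); last by rewrite /=; ring.
by repeat first [apply: rpredD | apply: rpredM | apply: rpredX | apply: rpred_nat | done].
Qed.

(** Geometric series with exact remainder: [1/(a - v) = 1/a + v/a^2 + v^2/(a^2 (a - v))] for
    [v = p u], where [a - v] stays prime to [p]. *)
Lemma affine_modp2V (p a : nat) : prime p -> (0 < a < p)%N ->
  affine_modp2 p (fun u => (a%:R - p%:R * u%:R)^-1).
Proof.
move=> pp ap; have pa := coprime_lt_prime pp ap.
have aZ := Zloc_natV pa; have a0 : a%:R != 0 :> rat by rewrite pnatr_eq0 -lt0n; case/andP: ap.
exists (a%:R^-1, a%:R^-1 ^+ 2); first by rewrite /= rpredX.
move=> u _; have pm : coprime p `|(a%:Z - p%:Z * u%:Z)%R|.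
  by rewrite -mulrN coprime_addMz.
have e : a%:R - p%:R * u%:R = ((a%:Z - p%:Z * u%:Z)%R : int)%:~R :> rat.
  by rewrite rmorphB rmorphM.
have m0 : a%:R - p%:R * u%:R != 0 :> rat.
  rewrite e intr_eq0; apply: contraTneq pm => ->.
  by rewrite /coprime absz0 gcdn0 gtn_eqF // prime_gt1.
exists (u%:R ^+ 2 * a%:R^-1 ^+ 2 * (a%:R - p%:R * u%:R)^-1).
  by rewrite !rpredM ?rpredX ?rpred_nat // e Zloc_intV.
by rewrite /=; field; rewrite m0 a0.
Qed.

Lemma affine_modp2_sum (p n : nat) (f : nat -> nat -> rat) :
  (forall k, (k < n)%N -> affine_modp2 p (f k)) ->
  affine_modp2 p (fun u => \sum_(0 <= k < n) f k u).
Proof.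
elim: n => [_|n IHn fP].
  exists (0, 0); rewrite /= ?rpred0 // => u _.
  by exists 0; rewrite ?rpred0 // big_geq // !mulr0 !addr0.
have [cd cdZ e] := affine_modp2D (IHn (fun k kn => fP k (ltnW kn))) (fP n (leqnn _)).
by exists cd => // u u3; rewrite big_nat_recr //=; apply: e.
Qed.

Lemma affine_modp2_prod (p n : nat) (f : nat -> nat -> rat) :
  (forall k, (k < n)%N -> affine_modp2 p (f k)) ->
  affine_modp2 p (fun u => \prod_(0 <= k < n) f k u).
Proof.
elim: n => [_|n IHn fP].
  exists (1, 0); rewrite /= ?rpred0 ?rpred1 // => u _.
  by exists 0; rewrite ?rpred0 // big_geq // !mulr0 !addr0.
have [cd cdZ e] := affine_modp2M (IHn (fun k kn => fP k (ltnW kn))) (fP n (leqnn _)).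
by exists cd => // u u3; rewrite big_nat_recr //=; apply: e.
Qed.

(** The second difference [f 0 - 2 f 1 + f 2] of an affine function vanishes. *)
Lemma affine_modp2_extrapolate (p : nat) (f : nat -> rat) : affine_modp2 p f ->
  f 0 \in Zloc p /\ exists2 r, r \in Zloc p & f 0 = 2%:R * f 1 - f 2 + p%:R ^+ 2 * r.
Proof.
move=> [[c d] /= [cZ dZ] fe].
have [e0 Z0 ->] := fe 0 isT; have [e1 Z1 ->] := fe 1 isT; have [e2 Z2 ->] := fe 2 isT.
split; last exists (e0 - 2%:R * e1 + e2); last by ring.
  by rewrite !rpredD ?rpredM ?rpredX ?rpred_nat.
by rewrite rpredD ?rpredB ?rpredM ?rpred_nat.
Qed.

(* [p e] is the truncated p-adic logarithm of [z], hence the additivity below. *)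
Definition log_modp2 (p : nat) (z e : rat) : Prop :=
  e \in Zloc p /\ exists2 r, r \in Zloc p & z = 1 + p%:R * e + p%:R ^+ 2 * r.

Lemma log_modp2_unit (p : nat) (z e : rat) :
  (1 < p)%N -> log_modp2 p z e -> z != 0 /\ z^-1 \in Zloc p.
Proof.
move=> p_gt1 [eZ [r rZ ->]].
rewrite (_ : 1 + _ + _ = 1 + p%:R * (e + p%:R * r)); last by ring.
by apply: Zloc_one_addV; rewrite // rpredD ?rpredM ?rpred_nat.
Qed.

Lemma log_modp2_lin (p : nat) (e : rat) : e \in Zloc p -> log_modp2 p (1 + p%:R * e) e.
Proof. by move=> eZ; split=> //; exists 0; rewrite ?rpred0 // mulr0 addr0. Qed.

Lemma log_modp2M (p : nat) (z z' e e' : rat) :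
  log_modp2 p z e -> log_modp2 p z' e' -> log_modp2 p (z * z') (e + e').
Proof.
move=> [eZ [r rZ ->]] [eZ' [r' rZ' ->]]; split; first exact: rpredD.
exists (e * e' + r * (1 + p%:R * e' + p%:R ^+ 2 * r') + r' * (1 + p%:R * e)); last by ring.
by repeat first [apply: rpredD | apply: rpredM | apply: rpredX | apply: rpred_nat
                 | apply: rpred1 | done].
Qed.

Lemma log_modp2V (p : nat) (z e : rat) : (1 < p)%N ->
  log_modp2 p z e -> log_modp2 p z^-1 (- e).
Proof.
move=> p_gt1 zl; have [z0 zV] := log_modp2_unit p_gt1 zl.
case: zl => eZ [r rZ zE]; split; first by rewrite rpredN.
(* This is [(1 - z (1 - p e)) / (p^2 z)] after expanding [z]. *)
exists (z^-1 * (e ^+ 2 - r + p%:R * e * r)).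
  by repeat first [apply: rpredD | apply: rpredM | apply: rpredX | apply: rpred_nat
                 | rewrite rpredN | done].
by rewrite zE in z0 *; field.
Qed.

(** * Harmonic sums as logarithms of products of factors close to 1 *)

(** For [a <= b] this is the difference [H_b - H_a] of harmonic numbers. *)
Definition harmonic (a b : nat) : rat := \sum_(a <= i < b) i.+1%:R^-1.

(* The factors are indexed by i + 1: the product runs over a < i <= b. *)
Definition twist (p : nat) (y : rat) (a b : nat) : rat :=
  \prod_(a <= i < b) (1 - p%:R * (y / i.+1%:R)).

(** Each factor [1 - p y / i] has logarithm [- y / i], and logarithms add up; [b < p] keeps every
    [i] prime to [p]. *)
Lemma twist_log (p : nat) (y : rat) (a b : nat) :
    prime p -> (b < p)%N -> y \in Zloc p ->
  log_modp2 p (twist p y a b) (- (y * harmonic a b)).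
Proof.
move=> pp bp yZ; rewrite /twist /harmonic.
have [ba | /ltnW ab] := leqP b a.
  rewrite !big_geq // mulr0 oppr0.
  by have := @log_modp2_lin p 0 (rpred0 _); rewrite mulr0 addr0.
elim: b ab bp => [|b IHb]; rewrite ?leqn0.
  move=> /eqP -> _; rewrite !big_geq // mulr0 oppr0.
  by have := @log_modp2_lin p 0 (rpred0 _); rewrite mulr0 addr0.
rewrite leq_eqVlt => /predU1P [-> | ab] bp.
  rewrite !big_geq // mulr0 oppr0.
  by have := @log_modp2_lin p 0 (rpred0 _); rewrite mulr0 addr0.
rewrite !big_nat_recr //= [y * (_ + _)]mulrDr opprD -mulrN.
apply: log_modp2M; first exact: IHb (ltnW bp).
by apply: log_modp2_lin; rewrite rpredN rpredM // Zloc_natV // coprime_lt_prime.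
Qed.

(** * Terminating hypergeometric sums, evaluated through a WZ recurrence *)

Definition rising (x : rat) (n : nat) : rat := \prod_(0 <= j < n) (x + j%:R).

(** The [n]-th term of 2F1(a, b; c; z), kept as the product of its successive term ratios, so that
    one vanishing upper factor kills all later terms. *)
Definition hyp_term (a b c z : rat) (n : nat) : rat :=
  \prod_(0 <= j < n) ((a + j%:R) * (b + j%:R) * z / (j.+1%:R * (c + j%:R))).

Lemma risingS (x : rat) (n : nat) : rising x n.+1 = rising x n * (x + n%:R).
Proof. by rewrite /rising big_nat_recr. Qed.

Lemma rising_gt0 (x : rat) (n : nat) : 0 < x -> 0 < rising x n.
Proof. by move=> x_gt0; apply: prodr_gt0 => i _; rewrite ltr_pwDl. Qed.

Lemma hyp_termS (a b c z : rat) (n : nat) :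
  hyp_term a b c z n.+1 = hyp_term a b c z n *
    ((a + n%:R) * (b + n%:R) * z / (n.+1%:R * (c + n%:R))).
Proof. by rewrite /hyp_term big_nat_recr. Qed.

Lemma hyp_term_eq0 (a b c z : rat) (m n : nat) :
  (m < n)%N -> a = - m%:R \/ b = - m%:R -> hyp_term a b c z n = 0.
Proof.
move=> mn ab; rewrite /hyp_term (bigD1_seq m) ?mem_index_iota ?iota_uniq //=.
by case: ab => ->; rewrite addNr !(mul0r, mulr0).
Qed.

(* With x = t - 1/3 this is the deformed term 2F1(1/3 - t, 2/3 - t; 1 - 3t; 9/8).
   The series terminates for x = m and for x = m + 1/3. *)
Definition cubic_term (x : rat) (n : nat) : rat :=
  hyp_term (- x) (1 / 3%:R - x) (- (3%:R * x)) (9%:R / 8%:R) n.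

Lemma cubic_term_eq0 (x : rat) (m n : nat) :
  x = m%:R \/ x = m%:R + 1 / 3%:R -> (m < n)%N -> cubic_term x n = 0.
Proof.
move=> xm mn; apply: (@hyp_term_eq0 _ _ _ _ m) => //.
by case: xm => ->; [left | right; ring].
Qed.

(** The terms are hypergeometric in [x] as well as in [k], so a unit shift of [x] costs only a
    rational factor, checked by induction on [k]. *)
Lemma cubic_term_shift (x : rat) (m k : nat) :
    0 < x -> x = m%:R \/ x = m%:R + 1 / 3%:R -> (k <= m.+1)%N ->
  cubic_term x k = cubic_term (x + 1) k *
    ((x + 1 - k%:R) * (3%:R * x + 2%:R - 3%:R * k%:R) * (3%:R * (3%:R * x + 1)) /
     ((3%:R * x + 3%:R - k%:R) * (3%:R * x + 2%:R - k%:R) * (3%:R * x + 1 - k%:R))).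
Proof.
move=> x_gt0 xm; have mx : m%:R <= x by case: xm => ->; lra.
rewrite leq_eqVlt => /predU1P [-> | ].
  (* At [k = m + 1] the left side is 0; on the right the factor [x + 1 - k] vanishes if [x = m], and
     [3 x + 2 - 3 k] if [x = m + 1/3]. *)
  rewrite (cubic_term_eq0 xm) // -natr1.
  by case: xm => ->; [rewrite subrr | set e := (X in _ * X * _ / _);
    have -> : e = 0 by rewrite /e; field]; rewrite !(mul0r, mulr0).
elim: k => [_ | k IHk km].
  rewrite /cubic_term /hyp_term !big_geq // mul1r !(mulr0, subr0, mulr0).
  by field; repeat (apply/andP; split); apply: lt0r_neq0; lra.
have kx : k%:R + 1 <= x by apply: le_trans mx; rewrite natr1 ler_nat.
have k0 : 0 <= k%:R :> rat by [].
have -> : cubic_term x k.+1 = cubic_term x k *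
    ((- x + k%:R) * (1 / 3%:R - x + k%:R) * (9%:R / 8%:R) / (k.+1%:R * (- (3%:R * x) + k%:R))).
  exact: hyp_termS.
rewrite [cubic_term (x + 1) _]hyp_termS -/(cubic_term (x + 1) k) IHk 1?ltnW // -natr1.
move: (cubic_term _ _) => t; field.
by repeat (apply/andP; split); first [done | apply: lt0r_neq0; lra | apply: ltr0_neq0; lra].
Qed.

(* The right-hand side is the WZ certificate, obtained by Gosper summation. *)
Lemma cubic_sum_partial (x : rat) (m n : nat) :
    0 < x -> x = m%:R \/ x = m%:R + 1 / 3%:R -> (n <= m.+2)%N ->
  \sum_(0 <= k < n) (cubic_term (x + 1) k -
      (x + 1 / 2%:R) / (2%:R * (x + 1 / 3%:R)) * cubic_term x k) =
  cubic_term (x + 1) n * n%:R * (8%:R * n%:R - 12%:R * x - 10%:R) /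
    ((3%:R * x + 3%:R - n%:R) * (3%:R * x + 2%:R - n%:R)).
Proof.
move=> x_gt0 xm; have mx : m%:R <= x by case: xm => ->; lra.
elim: n => [_ | n IHn nm]; first by rewrite big_geq // mulr0 !mul0r.
rewrite big_nat_recr //= IHn 1?ltnW // (cubic_term_shift x_gt0 xm) //.
have nx : n%:R <= x + 1 by rewrite -lerBlDr; apply: le_trans mx; rewrite lerBlDr natr1 ler_nat.
have n0 : 0 <= n%:R :> rat by [].
rewrite [cubic_term (x + 1) n.+1]hyp_termS -/(cubic_term (x + 1) n) -natr1.
move: (cubic_term _ _) => t; field.
by repeat (apply/andP; split); first [done | apply: lt0r_neq0; lra | apply: ltr0_neq0; lra].
Qed.

(** At [n = m + 2] the closed form of the partial sums carries the factor [cubic_term (x + 1) m.+2],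
    which is 0, so the two complete sums are proportional. *)
Lemma cubic_sumS (x : rat) (m : nat) :
    0 < x -> x = m%:R \/ x = m%:R + 1 / 3%:R ->
  \sum_(0 <= k < m.+2) cubic_term (x + 1) k =
  (x + 1 / 2%:R) / (2%:R * (x + 1 / 3%:R)) * \sum_(0 <= k < m.+1) cubic_term x k.
Proof.
move=> x_gt0 xm; have := cubic_sum_partial x_gt0 xm (leqnn m.+2).
rewrite (@cubic_term_eq0 _ m.+1) //; last first.
  by case: xm => ->; rewrite -natr1; [left | right; ring].
rewrite !mul0r sumrB -mulr_sumr [X in _ - _ * X]big_nat_recr //=.
by rewrite (cubic_term_eq0 xm) // addr0 => /subr0_eq.
Qed.

(** Terms beyond [m] vanish, and [cubic_sumS] is iterated from [x = 1]. *)
Lemma cubic_sum1 (m n : nat) : (m < n)%N -> (0 < m)%N ->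
  \sum_(0 <= k < n) cubic_term m%:R k =
  rising (1 / 2%:R) m / (2%:R ^+ m * rising (1 / 3%:R) m).
Proof.
move=> mn m_gt0; rewrite (big_cat_nat (n := m.+1)) //= [X in _ + X]big1_seq ?addr0; last first.
  move=> i; rewrite mem_index_iota => /andP [_ /andP [mi _]].
  by apply: cubic_term_eq0 mi; left.
  (* The induction starts at 1: at [x = 0] the lower parameter [- 3 x] vanishes, and the recurrence
     requires [0 < x]. *)
  case: m m_gt0 {mn} => // m _; elim: m => [|m IHm].
    rewrite big_nat_recr // big_nat1 /cubic_term /hyp_term /rising !big_nat1.
    by rewrite big_geq.
  rewrite -[in LHS]natr1 cubic_sumS ?IHm //; last by left.
  rewrite [_ ^+ m.+2]exprS [rising _ m.+2]risingS [rising (1 / 3%:R) m.+2]risingS.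
  have r0 : rising (1 / 3%:R) m.+1 != 0.
    exact/lt0r_neq0/rising_gt0.
  have m0 : 0 <= m.+1%:R :> rat by [].
  have e0 : 2%:R ^+ m.+1 != 0 :> rat by rewrite expf_neq0.
  field; rewrite r0 e0 /=.
  by repeat (apply/andP; split); first [done | apply: lt0r_neq0; lra | apply: ltr0_neq0; lra].
Qed.

(** The same recurrence, iterated from [x = 1/3], where the series reduces to its first term 1. *)
Lemma cubic_sum2 (m n : nat) : (m < n)%N ->
  \sum_(0 <= k < n) cubic_term (m%:R + 1 / 3%:R) k =
  rising (5%:R / 6%:R) m / (2%:R ^+ m * rising (2%:R / 3%:R) m).
Proof.
move=> mn; rewrite (big_cat_nat (n := m.+1)) //= [X in _ + X]big1_seq ?addr0; last first.
  move=> i; rewrite mem_index_iota => /andP [_ /andP [mi _]].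
  by apply: cubic_term_eq0 mi; right.
  elim: m {mn} => [|m IHm].
    by rewrite big_nat1 /cubic_term /hyp_term /rising !big_geq.
  have m0 : 0 <= m%:R :> rat by [].
  rewrite -[in LHS]natr1 addrAC cubic_sumS ?IHm //; [|lra|by right].
  rewrite exprS [rising _ m.+1]risingS [rising (2%:R / 3%:R) m.+1]risingS.
  have r0 : rising (2%:R / 3%:R) m != 0.
    exact/lt0r_neq0/rising_gt0.
  have e0 : 2%:R ^+ m != 0 :> rat by rewrite expf_neq0.
  field; rewrite r0 e0 /=.
  by repeat (apply/andP; split); first [done | apply: lt0r_neq0; lra | apply: ltr0_neq0; lra].
Qed.

(** * Rising factorials as factorials times factors close to 1 *)

Lemma fact_neq0 (n : nat) : n`!%:R != 0 :> rat.
Proof. by rewrite pnatr_eq0 -lt0n fact_gt0. Qed.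

Lemma risingSl (x : rat) (n : nat) : rising x n.+1 = x * rising (x + 1) n.
Proof.
rewrite /rising big_nat_recl // addr0; congr (_ * _).
by apply: eq_bigr => i _; rewrite -addrA nat1r.
Qed.

Lemma rising_fact (a k : nat) : rising (a%:R + 1) k = (a + k)`!%:R / a`!%:R.
Proof.
elim: k => [|k IHk]; first by rewrite /rising big_geq // addn0 divff ?fact_neq0.
rewrite risingS IHk addnS factS natrM -natr1 natrD.
have := fact_neq0 a; move: (a`!%:R) => t t0.
by field.
Qed.

(** The factors are [p y - i] for [a < i <= b]; pulling [- i] out of each leaves [1 - p y / i]. *)
Lemma rising_twist (p : nat) (y : rat) (a b : nat) : (a <= b)%N ->
  rising (p%:R * y - b%:R) (b - a) =
  (-1) ^+ (b - a) * (b`!%:R / a`!%:R) * twist p y a b.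
Proof.
move=> /subnKC <-; rewrite addKn; move: (b - a)%N => k {b}.
elim: k => [|k IHk].
  by rewrite /rising /twist addn0 !big_geq // divff ?fact_neq0 // !mulr1.
rewrite risingSl.
rewrite (_ : _ - _ + 1 = p%:R * y - (a + k)%:R); last by rewrite addnS -natr1; ring.
rewrite IHk /twist addnS big_nat_recr ?leq_addr //= factS natrM exprS.
have k0 : (a + k).+1%:R != 0 :> rat by rewrite pnatr_eq0.
have := fact_neq0 a; move: (a`!%:R) ((a + k).+1%:R) k0 => t q q0 t0.
by field; rewrite t0 q0.
Qed.

Lemma rising_twist0 (p : nat) (y : rat) (b : nat) :
  rising (p%:R * y - b%:R) b = (-1) ^+ b * b`!%:R * twist p y 0 b.
Proof. by have := rising_twist p y (leq0n b); rewrite subn0 (divr1 b`!%:R). Qed.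

(** Here the factors are [p y + i], whence the opposite sign of [y]. This handles the factors
    following a multiple of [p]. *)
Lemma rising_twistN (p : nat) (y : rat) (k : nat) :
  rising (p%:R * y + 1) k = k`!%:R * twist p (- y) 0 k.
Proof.
elim: k => [|k IHk]; first by rewrite /rising /twist !big_geq ?mulr1.
rewrite risingS IHk /twist big_nat_recr //= factS natrM.
have k0 : k.+1%:R != 0 :> rat by rewrite pnatr_eq0.
by rewrite -addrA nat1r; move: (k.+1%:R) k0 => q q0; field.
Qed.

(** Duplication: the even factors are [2 i], the odd ones [2 (i - 1/2)]. *)
Lemma fact_double (k : nat) :
  (2 * k)`!%:R = 4%:R ^+ k * k`!%:R * rising (1 / 2%:R) k.
Proof.
elim: k => [|k IHk]; first by rewrite /rising big_geq // !mulr1.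
rewrite (_ : 2 * k.+1 = (2 * k).+2)%N; last by lia.
rewrite !factS !natrM IHk risingS exprS -!natr1 natrM.
by field.
Qed.

(** An exact form of Fermat's theorem for [2^(p - 1)]. It compares two values of [(p - 1)!]: [m!]
    times the factors [p - i], and the duplication formula, in which [1/2 = p/2 - m] turns the
    half-integers into factors [p/2 - i]. *)
Lemma pow4_twist (p m : nat) : prime p -> p = (2 * m).+1 ->
  4%:R ^+ m = twist p 1 0 m / twist p (1 / 2%:R) 0 m.
Proof.
move=> pp pE; have p_gt1 := prime_gt1 pp.
have mp : (m < p)%N by lia.
have pQ : p%:R = 2%:R * m%:R + 1 :> rat by rewrite pE -[LHS]natr1 natrM.
have y2 : 1 / 2%:R \in Zloc p.
  by rewrite div1r Zloc_natV // coprime_lt_prime //; lia.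
have [t0 _] := log_modp2_unit p_gt1 (twist_log 0 pp mp y2).
have s0 : (-1) ^+ m != 0 :> rat by rewrite signr_eq0.
have m0 := fact_neq0 m.
have E1 : (2 * m)`!%:R = m`!%:R * ((-1) ^+ m * m`!%:R * twist p 1 0 m).
  rewrite -rising_twist0.
  have := rising_fact m m; rewrite addnn -mul2n => e.
  rewrite (_ : _ * 1 - _ = m%:R + 1); last by rewrite pQ; ring.
  by rewrite e mulrC divfK.
have E2 := fact_double m.
have E3 : rising (1 / 2%:R) m = (-1) ^+ m * m`!%:R * twist p (1 / 2%:R) 0 m.
  rewrite -rising_twist0.
  by congr rising; rewrite pQ; field.
move: E1; rewrite E2 E3; move: (4%:R ^+ m) => Q E1.
apply: (mulIf t0); rewrite divfK //.
apply: (mulfI (mulf_neq0 (mulf_neq0 m0 s0) m0)).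
transitivity (Q * m`!%:R * ((-1) ^+ m * m`!%:R * twist p (1 / 2%:R) 0 m)); first by ring.
by rewrite E1; ring.
Qed.

(** * Congruences modulo [p] between harmonic numbers *)

Lemma harmonic_cat (a b c : nat) : (a <= b)%N -> (b <= c)%N ->
  harmonic a c = harmonic a b + harmonic b c.
Proof. exact: big_cat_nat. Qed.

(** The range is symmetric under [i -> p - i], and [1/i + 1/(p - i) = p/(i (p - i))]. Adding the
    reversed sum doubles the left side, whence the factor 1/2 in the witness. *)
Lemma harmonic_sym (p k : nat) : prime p -> (2 < p)%N -> (k <= p - 1 - k)%N ->
  exists2 r, r \in Zloc p & harmonic k (p - 1 - k) = p%:R * r.
Proof.
move=> pp p_gt2 kp.
have pair i : (k <= i < p - 1 - k)%N ->
    i.+1%:R^-1 + (k + (p - 1 - k) - i.+1).+1%:R^-1 =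
    p%:R * (i.+1%:R^-1 * (p - i.+1)%:R^-1) :> rat.
  move=> ik; have -> : (k + (p - 1 - k) - i.+1).+1 = (p - i.+1)%N by lia.
  have i0 : i.+1%:R != 0 :> rat by rewrite pnatr_eq0.
  have j0 : (p - i.+1)%:R != 0 :> rat by rewrite pnatr_eq0; lia.
  have -> : p%:R = i.+1%:R + (p - i.+1)%:R :> rat by rewrite -natrD subnKC //; lia.
  by move: (i.+1%:R) ((p - i.+1)%:R) i0 j0 => x y x0 y0; field; rewrite x0 y0.
exists (1 / 2%:R * \sum_(k <= i < p - 1 - k) (i.+1%:R^-1 * (p - i.+1)%:R^-1)).
  rewrite div1r rpredM ?Zloc_natV ?coprime_lt_prime //.
  rewrite big_seq rpred_sum // => i; rewrite mem_index_iota => ik.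
  by rewrite rpredM // Zloc_natV // coprime_lt_prime //; lia.
rewrite mulrCA; have <- : harmonic k (p - 1 - k) + harmonic k (p - 1 - k) =
    p%:R * \sum_(k <= i < p - 1 - k) (i.+1%:R^-1 * (p - i.+1)%:R^-1).
  rewrite mulr_sumr [in X in _ + X]/harmonic big_nat_rev -big_split.
  by apply: eq_big_nat => i ik; apply: pair.
by field.
Qed.

(** Splitting [H_{2h}] into even and odd denominators turns the left side into twice the sum of
    [1/(2j + 1) + 1/(6h - 2j)] over [j < h], and the two denominators add up to [p]. *)
Lemma harmonic_double (p h : nat) : prime p -> (2 < p)%N -> (p = 6 * h + 1)%N ->
  exists2 r, r \in Zloc p &
    harmonic 0 (3 * h) + harmonic 0 (2 * h) - harmonic 0 h = p%:R * r.
Proof.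
move=> pp p_gt2 pE.
have odd_even n : harmonic 0 (2 * n) =
    1 / 2%:R * harmonic 0 n + \sum_(0 <= j < n) (2 * j + 1)%:R^-1.
  rewrite /harmonic; elim: n => [|n IHn]; first by rewrite !big_geq // mulr0 addr0.
  rewrite (_ : 2 * n.+1 = (2 * n).+2)%N; last by lia.
  rewrite !big_nat_recr //= IHn addn1.
  have -> : (2 * n).+2%:R = 2%:R * n.+1%:R :> rat by rewrite -natrM; congr _%:R; lia.
  have n0 : n.+1%:R != 0 :> rat by rewrite pnatr_eq0.
  have m0 : (2 * n).+1%:R != 0 :> rat by rewrite pnatr_eq0.
  by move: (n.+1%:R) ((2 * n).+1%:R) n0 m0 => x y x0 y0; field; rewrite x0 y0.
have rev : harmonic (2 * h) (3 * h) = \sum_(0 <= j < h) (3 * h - j)%:R^-1.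
  rewrite /harmonic big_nat_rev -[X in \sum_(X <= _ < _) _]add0n big_addn.
  rewrite (_ : 3 * h - 2 * h = h)%N; last by lia.
  by apply: eq_big_nat => i ih; congr (_%:R^-1); lia.
exists (2%:R * \sum_(0 <= j < h) ((2 * j + 1)%:R^-1 * (2 * (3 * h - j))%:R^-1)).
  rewrite rpredM ?rpred_nat // big_seq rpred_sum // => j; rewrite mem_index_iota => jh.
  by rewrite rpredM // Zloc_natV // coprime_lt_prime //; lia.
have -> : harmonic 0 (3 * h) + harmonic 0 (2 * h) - harmonic 0 h =
    2%:R * \sum_(0 <= j < h) ((2 * j + 1)%:R^-1 + (2 * (3 * h - j))%:R^-1).
  rewrite big_split /= (@harmonic_cat 0 (2 * h) (3 * h)) //; last by lia.
  have -> : \sum_(0 <= j < h) (2 * (3 * h - j))%:R^-1 = 1 / 2%:R * harmonic (2 * h) (3 * h).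
    by rewrite rev mulr_sumr; apply: eq_bigr => j _; rewrite natrM invfM mul1r.
  by rewrite {1 2}odd_even; move: (harmonic _ _) (\sum_(_ <= _ < _) _) => a b; field.
rewrite mulrCA; congr (_ * _); rewrite mulr_sumr; apply: eq_big_nat => j jh.
have i0 : (2 * j + 1)%:R != 0 :> rat by rewrite pnatr_eq0; lia.
have j0 : (2 * (3 * h - j))%:R != 0 :> rat by rewrite pnatr_eq0; lia.
have -> : p%:R = (2 * j + 1)%:R + (2 * (3 * h - j))%:R :> rat by rewrite -natrD; congr _%:R; lia.
by move: ((2 * j + 1)%:R) ((2 * (3 * h - j))%:R) i0 j0 => x y x0 y0; field; rewrite x0 y0.
Qed.

(** * The undeformed terms, and extrapolation from the deformed sums *)

(** Both sides are [(3k)! / (k!^3 24^k)]: the term ratios agree since [27/24 = 9/8]. *)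
Lemma cubic_term_bin (k : nat) :
  cubic_term (- (1 / 3%:R)) k = 'C(2 * k, k)%:R * 'C(3 * k, k)%:R / 24%:R ^+ k.
Proof.
have fact3 : (3 * k)`!%:R = 'C(2 * k, k)%:R * 'C(3 * k, k)%:R * k`!%:R ^+ 3 :> rat.
  have <- : ('C(3 * k, k) * (k`! * ('C(2 * k, k) * (k`! * k`!))))%N = (3 * k)`!.
    have k3 : (k <= 3 * k)%N by lia.
    have k2 : (k <= 2 * k)%N by lia.
    have e2 := bin_fact k2; have e3 := bin_fact k3.
    rewrite (_ : 2 * k - k = k)%N in e2; last by lia.
    rewrite (_ : 3 * k - k = 2 * k)%N in e3; last by lia.
    by rewrite [in LHS]mulnCA e2 mulnCA.
  by rewrite !natrM; ring.
suff E : cubic_term (- (1 / 3%:R)) k = (3 * k)`!%:R / (k`!%:R ^+ 3 * 24%:R ^+ k).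
  rewrite E fact3; have := fact_neq0 k; move: (k`!%:R) => t t0.
  have e0 : 24%:R ^+ k != 0 :> rat by rewrite expf_neq0.
  by move: (24%:R ^+ k) e0 => e e0; field; rewrite t0 e0.
elim: k {fact3} => [|k IHk].
  by rewrite /cubic_term /hyp_term big_geq // !fact0.
rewrite /cubic_term hyp_termS -/(cubic_term _ _) IHk [24%:R ^+ k.+1]exprS.
rewrite (_ : 3 * k.+1 = (3 * k).+3)%N; last by lia.
rewrite !factS !natrM -!(natr1 (3 * k).+2) -!(natr1 (3 * k).+1) -!(natr1 (3 * k)) natrM.
have k0 : 0 <= k%:R :> rat by [].
rewrite -(natr1 k); move: (k%:R) k0 => q q0.
have := fact_neq0 k; move: (k`!%:R) => t t0.
have e0 : 24%:R ^+ k != 0 :> rat by rewrite expf_neq0.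
move: (24%:R ^+ k) e0 => e e0; move: ((3 * k)`!%:R) => f.
field; rewrite t0 e0 /=.
by repeat (apply/andP; split); first [done | apply: lt0r_neq0; lra | apply: ltr0_neq0; lra].
Qed.

(** At [x = (p u - 1)/3] every factor of every term is affine in [u] modulo [p^2], hence so is the
    sum. *)
Lemma cubic_sum_modp2 (p : nat) : prime p -> (3 < p)%N ->
  let T (u : nat) : rat := \sum_(0 <= k < p) cubic_term ((p%:R * u%:R - 1) / 3%:R) k in
  T 0 \in Zloc p /\
  exists2 r, r \in Zloc p & T 0 = 2%:R * T 1 - T 2 + p%:R ^+ 2 * r.
Proof.
move=> pp p_gt3 T; apply: affine_modp2_extrapolate.
have p3 : 3%:R^-1 \in Zloc p by rewrite Zloc_natV // coprime_lt_prime.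
have p8 : 8%:R^-1 \in Zloc p.
  by rewrite Zloc_natV // (_ : 8 = 2 ^ 3)%N // coprimeXr // coprime_lt_prime //; lia.
apply: affine_modp2_sum => k kp; apply: affine_modp2_prod => j jk.
have linear (c d : rat) (g : nat -> rat) : c \in Zloc p -> d \in Zloc p ->
    (forall u, g u = c + p%:R * u%:R * d) -> affine_modp2 p g.
  move=> cZ dZ gE; have [cd cdZ ce] := affine_modp2_eq cZ dZ.
  by exists cd => // u u3; rewrite gE; apply: ce.
apply: affine_modp2M; first apply: affine_modp2M; first apply: affine_modp2M.
- apply: (linear (3%:R^-1 + j%:R) (- 3%:R^-1)); rewrite ?rpredD ?rpredN ?rpred_nat // => u.
  by field.
- apply: (linear (2%:R * 3%:R^-1 + j%:R) (- 3%:R^-1)) => [||u]; last by field.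
    by rewrite rpredD ?rpredM ?rpred_nat.
  by rewrite rpredN.
- apply: (linear (9%:R * 8%:R^-1) 0) => [||u]; last by ring.
    by rewrite rpredM ?rpred_nat.
  exact: rpred0.
(* The lower parameter contributes [j + 1 - p u], invertible because [j + 1 <= k < p]. *)
have := affine_modp2M (affine_modp2_eq (_ : j.+1%:R^-1 \in Zloc p) (rpred0 _))
          (affine_modp2V pp (_ : (0 < j.+1 < p)%N)).
case=> [||cd cdZ ce]; [|lia|exists cd => // u u3].
  by rewrite Zloc_natV // coprime_lt_prime //; lia.
have [e eZ eE] := ce u u3; exists e => //; rewrite -eE mulr0 addr0 invfM.
by congr (_ * _^-1); rewrite -natr1; field.
Qed.

(** * The combination [2 T(1) - T(2)] for [p = 6 h + 1] *)

Lemma central_bin (n : nat) : 'C(2 * n, n)%:R = (2 * n)`!%:R / n`!%:R ^+ 2 :> rat.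
Proof.
have n2 : (n <= 2 * n)%N by lia.
rewrite -(bin_fact n2) (_ : 2 * n - n = n)%N; last by lia.
by rewrite !natrM -expr2 mulfK // expf_neq0 // fact_neq0.
Qed.

Lemma rising_cat (x : rat) (m n : nat) :
  rising x (m + n) = rising x m * rising (x + m%:R) n.
Proof.
elim: n => [|n IHn]; first by rewrite addn0 [rising _ 0]big_geq // mulr1.
by rewrite addnS !risingS IHn natrD addrA mulrA.
Qed.

Lemma sign_cases (n : nat) : (-1) ^+ n = 1 :> rat \/ (-1) ^+ n = -1 :> rat.
Proof. by rewrite -signr_odd; case: odd; [right | left]. Qed.

(** Both quotients are the binomial coefficient times some [z1], [z2] congruent to 1 modulo [p], so
    it suffices that twice the logarithm of [z1] minus that of [z2] vanishes modulo [p]. *)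
Lemma cubic_sum_combination1 (p h : nat) : prime p -> (p = 6 * h + 1)%N ->
  exists2 r, r \in Zloc p &
    2%:R * (rising (1 / 2%:R) (2 * h) / (2%:R ^+ (2 * h) * rising (1 / 3%:R) (2 * h))) -
      rising (5%:R / 6%:R) (4 * h) / (2%:R ^+ (4 * h) * rising (2%:R / 3%:R) (4 * h)) =
    'C(4 * h, 2 * h)%:R + p%:R ^+ 2 * r.
Proof.
move=> pp pE; have p_gt1 := prime_gt1 pp; have h_gt0 : (0 < h)%N by lia.
have p_gt2 : (2 < p)%N by lia.
have b2 : (2 * h < p)%N by lia.
have b3 : (3 * h < p)%N by lia.
have b4 : (4 * h < p)%N by lia.
have b5 : (5 * h < p)%N by lia.
have h5 : (p - 1 - h = 5 * h)%N by lia.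
have h4 : (p - 1 - 2 * h = 4 * h)%N by lia.
have h1 : (h <= p - 1 - h)%N by lia.
have h2 : (2 * h <= p - 1 - 2 * h)%N by lia.
have h12 : (h <= 2 * h)%N by lia.
have h23 : (2 * h <= 3 * h)%N by lia.
have h24 : (2 * h <= 4 * h)%N by lia.
have pQ : p%:R = 6%:R * h%:R + 1 :> rat by rewrite pE natrD natrM.
have Z2 : 1 / 2%:R \in Zloc p by rewrite div1r Zloc_natV // coprime_lt_prime //; lia.
have Z3 : 1 / 3%:R \in Zloc p by rewrite div1r Zloc_natV // coprime_lt_prime //; lia.
have Z23 : 2%:R / 3%:R \in Zloc p by rewrite Zloc_ratio // coprime_lt_prime //; lia.
have Z56 : 5%:R / 6%:R \in Zloc p by rewrite Zloc_ratio // coprime_lt_prime //; lia.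
have W := pow4_twist pp (_ : p = (2 * (3 * h)).+1).
have {W} W : 4%:R ^+ (3 * h) = twist p 1 0 (3 * h) / twist p (1 / 2%:R) 0 (3 * h) by apply: W; lia.
(* The starting points are [1/2 = p/2 - 3h], [1/3 = p/3 - 2h], [2/3 = 2p/3 - 4h] and
   [5/6 = 5p/6 - 5h]; all lengths are even, so no sign appears. *)
have R12 : rising (1 / 2%:R) (2 * h) = (3 * h)`!%:R / h`!%:R * twist p (1 / 2%:R) h (3 * h).
  have := rising_twist p (1 / 2%:R) (_ : h <= 3 * h)%N.
  rewrite (_ : 3 * h - h = 2 * h)%N; last by lia.
  rewrite exprM sqrrN expr1n [1 * (_ / _)]mul1r => <-; last by lia.
  by congr rising; rewrite pQ natrM; field.
have R13 : rising (1 / 3%:R) (2 * h) = (2 * h)`!%:R * twist p (1 / 3%:R) 0 (2 * h).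
  have := rising_twist0 p (1 / 3%:R) (2 * h).
  rewrite [_ ^+ (2 * h)]exprM sqrrN !expr1n [1 * _`!%:R]mul1r => <-.
  by congr rising; rewrite pQ natrM; field.
have R23 : rising (2%:R / 3%:R) (4 * h) = (4 * h)`!%:R * twist p (2%:R / 3%:R) 0 (4 * h).
  have := rising_twist0 p (2%:R / 3%:R) (4 * h).
  rewrite (_ : (-1) ^+ (4 * h) = 1); last by rewrite -signr_odd oddM.
  by rewrite [1 * _`!%:R]mul1r => <-; congr rising; rewrite pQ natrM; field.
have R56 : rising (5%:R / 6%:R) (4 * h) =
    (5 * h)`!%:R / h`!%:R * twist p (5%:R / 6%:R) h (5 * h).
  have := rising_twist p (5%:R / 6%:R) (_ : h <= 5 * h)%N.
  rewrite (_ : 5 * h - h = 4 * h)%N; last by lia.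
  rewrite (_ : (-1) ^+ (4 * h) = 1); last by rewrite -signr_odd oddM.
  by rewrite [1 * (_ / _)]mul1r => <-; [congr rising; rewrite pQ natrM; field | lia].
(* The factors [4h + 1, ..., 5h] are [p - i] for [h < i <= 2h]. *)
have F5 : (5 * h)`!%:R / (4 * h)`!%:R =
    (-1) ^+ h * ((2 * h)`!%:R / h`!%:R) * twist p 1 h (2 * h).
  have := rising_twist p 1 (_ : h <= 2 * h)%N; have := rising_fact (4 * h) h.
  rewrite (_ : 4 * h + h = 5 * h)%N; last by lia.
  rewrite (_ : 2 * h - h = h)%N; last by lia.
  by move=> <- <-; [congr rising; rewrite pQ !natrM; ring | lia].
(* Duplication again, now with [(1/2)_h] as the product of [p/2 - i] over [2h < i <= 3h]; this ties
   [(2h)!^2] to [h! (3h)!]. *)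
have F2 : (2 * h)`!%:R = 4%:R ^+ h * h`!%:R *
    ((-1) ^+ h * ((3 * h)`!%:R / (2 * h)`!%:R) * twist p (1 / 2%:R) (2 * h) (3 * h)).
  rewrite [LHS]fact_double; have := rising_twist p (1 / 2%:R) (_ : 2 * h <= 3 * h)%N.
  rewrite (_ : 3 * h - 2 * h = h)%N; last by lia.
  by move=> <-; [congr (_ * rising _ _); rewrite pQ natrM; field | lia].
have F4 := fact_double (2 * h); rewrite R12 (_ : 2 * (2 * h) = 4 * h)%N in F4; last by lia.
have C4 := central_bin (2 * h); rewrite (_ : 2 * (2 * h) = 4 * h)%N in C4; last by lia.
have tl y a b : (b < p)%N -> y \in Zloc p -> log_modp2 p (twist p y a b) (- (y * harmonic a b)).
  by move=> bp yZ; apply: twist_log.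
have tn y a b : (b < p)%N -> y \in Zloc p -> twist p y a b != 0.
  by move=> bp yZ; have [] := log_modp2_unit p_gt1 (tl y a b bp yZ).
have Wl : log_modp2 p (4%:R ^+ (3 * h))
    (- (1 * harmonic 0 (3 * h)) + - - (1 / 2%:R * harmonic 0 (3 * h))).
  by rewrite W; apply: log_modp2M; [apply: tl | apply: log_modp2V => //; apply: tl];
    rewrite ?rpred1.
have e22 : 2%:R ^+ (2 * h) = 4%:R ^+ h :> rat by rewrite exprM -natrX.
have e24 : 2%:R ^+ (4 * h) = 4%:R ^+ h ^+ 2 :> rat.
  by rewrite -e22 -exprM; congr (_ ^+ _); lia.
have e42 : 4%:R ^+ (2 * h) = 4%:R ^+ h ^+ 2 :> rat by rewrite mulnC exprM.
have e43 : 4%:R ^+ (3 * h) = 4%:R ^+ h ^+ 3 :> rat by rewrite mulnC exprM.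
have Q0 : 4%:R ^+ h != 0 :> rat by rewrite expf_neq0.
have Zl1 : 1 \in Zloc p := rpred1 _.
(* [z1] and [z2] are the exact cofactors of the binomial coefficient; the power of 4 is
   [2^(p - 1)]. *)
pose z1 := (4%:R ^+ (3 * h))^-1 * (twist p (1 / 3%:R) 0 (2 * h))^-1.
pose z2 := (4%:R ^+ (3 * h))^-1 * (twist p (1 / 2%:R) (2 * h) (3 * h) *
    (twist p 1 h (2 * h) * (twist p (5%:R / 6%:R) h (5 * h) *
     ((twist p (2%:R / 3%:R) 0 (4 * h))^-1 * (twist p (1 / 2%:R) h (3 * h))^-1)))).
have E1 : rising (1 / 2%:R) (2 * h) / (2%:R ^+ (2 * h) * rising (1 / 3%:R) (2 * h)) =
    'C(4 * h, 2 * h)%:R * z1.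
  have := tn (1 / 3%:R) 0 (2 * h) b2 Z3; rewrite /z1 C4 F4 R12 R13 e22 e42 e43.
  move: (twist p _ _ _) (twist p _ _ _) => t t' t0.
  move: (fact_neq0 (2 * h)) (fact_neq0 h) Q0.
  move: ((2 * h)`!%:R) (h`!%:R) (4%:R ^+ h) ((3 * h)`!%:R) => F1' F2' Q F3' f1 f2 Q0.
  by field; rewrite t0 f1 f2 Q0.
have E2 : rising (5%:R / 6%:R) (4 * h) / (2%:R ^+ (4 * h) * rising (2%:R / 3%:R) (4 * h)) =
    'C(4 * h, 2 * h)%:R * z2.
  have F5' : (5 * h)`!%:R = (4 * h)`!%:R *
      ((-1) ^+ h * ((2 * h)`!%:R / h`!%:R) * twist p 1 h (2 * h)).
    by rewrite -F5 mulrC divfK // fact_neq0.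
  rewrite /z2 C4 R23 R56 e24 e43 F5' {F5 F5' R12 R13 R23 R56 C4 E1 z1 z2}.
  have := tn (2%:R / 3%:R) 0 (4 * h) b4 Z23.
  move=> t0; have := tn (1 / 2%:R) h (3 * h) b3 Z2.
  move=> t1; move: F4 F2; rewrite e42.
  move: (fact_neq0 (2 * h)) (fact_neq0 h) (fact_neq0 (4 * h)) (fact_neq0 (3 * h)) Q0 t0 t1.
  move: (twist p _ 0 (4 * h)) (twist p _ h (3 * h)) (twist p _ (2 * h) (3 * h))
    (twist p _ h (2 * h)) (twist p _ h (5 * h)) => P23 P12a P12b P1 P56.
  move: ((2 * h)`!%:R) (h`!%:R) ((4 * h)`!%:R) ((3 * h)`!%:R) (4%:R ^+ h).
  move=> f2 f1 f4 f3 Q f20 f10 f40 f30 Q0 t0 t1 F4 F2.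
  (* This is [F2] cleared of denominators, with the sign moved across. *)
  have K : Q * f1 * f3 * P12b = (-1) ^+ h * f2 ^+ 2.
    have -> : f2 ^+ 2 = Q * f1 * ((-1) ^+ h * f3 * P12b).
      by rewrite expr2 {1}F2; field.
    by case: (sign_cases h) => ->; ring.
  transitivity ((-1) ^+ h * f2 ^+ 2 * P1 * P56 / (f1 ^+ 2 * f2 * Q ^+ 2 * P23)).
    by field; rewrite f20 f10 f40 Q0 t0.
  by rewrite -K F4; field; rewrite f20 f10 Q0 t0 t1.
pose W' := - (1 * harmonic 0 (3 * h)) + - - (1 / 2%:R * harmonic 0 (3 * h)).
have z1l : log_modp2 p z1 (- W' + - - (1 / 3%:R * harmonic 0 (2 * h))).
  by apply: log_modp2M; apply: log_modp2V => //; apply: tl.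
have z2l : log_modp2 p z2 (- W' + (- (1 / 2%:R * harmonic (2 * h) (3 * h)) +
    (- (1 * harmonic h (2 * h)) + (- (5%:R / 6%:R * harmonic h (5 * h)) +
     (- - (2%:R / 3%:R * harmonic 0 (4 * h)) + - - (1 / 2%:R * harmonic h (3 * h))))))).
  apply: log_modp2M; first by apply: log_modp2V => //; exact: Wl.
  apply: log_modp2M; first by apply: tl.
  apply: log_modp2M; first by apply: tl.
  apply: log_modp2M; first by apply: tl.
  by apply: log_modp2M; apply: log_modp2V => //; apply: tl.
case: z1l => _ [r1 Zr1 z1r]; case: z2l => _ [r2 Zr2 z2r].
have [s1 sZ1 s1E] := harmonic_sym pp p_gt2 h1.
have [s2 sZ2 s2E] := harmonic_sym pp p_gt2 h2.
have [s3 sZ3 s3E] := harmonic_double pp p_gt2 pE.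
rewrite h5 in s1E.
rewrite h4 in s2E.
rewrite E1 E2 z1r z2r {E1 E2 z1r z2r z1 z2 Wl W tl tn R12 R13 R23 R56 F5 F2 F4 C4}.
rewrite /W' s1E (harmonic_cat (leq0n _) h24) s2E.
rewrite (harmonic_cat h12 h23).
have e1 := harmonic_cat (leq0n _) h12; have e2 := harmonic_cat (leq0n _) h23.
rewrite e2 e1 in s3E *.
(* Modulo [p] the logarithms combine to half of [H_{3h} + H_{2h} - H_h], which gives [s3 / 2]; [s1]
   and [s2] come from replacing [H_{5h}] by [H_h] and [H_{4h}] by [H_{2h}]. *)
exists ('C(4 * h, 2 * h)%:R *
    (1 / 2%:R * s3 + 2%:R * r1 - r2 + 5%:R / 6%:R * s1 - 2%:R / 3%:R * s2)).
  by rewrite rpredM ?rpred_nat // rpredB ?rpredD ?rpredN // rpredM ?rpred_nat.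
have -> : harmonic (2 * h) (3 * h) = p%:R * s3 - harmonic 0 h - 2%:R * harmonic h (2 * h).
  by rewrite -s3E; ring.
by field.
Qed.

(** * The combination [2 T(1) - T(2)] for [p = 6 h + 5] *)

(** Precision modulo [p] is enough in this case, since both sums have an explicit factor [p]. *)
Definition one_modp (p : nat) (z : rat) : Prop :=
  exists2 s, s \in Zloc p & z = 1 + p%:R * s.

Lemma one_modpM (p : nat) (z z' : rat) :
  one_modp p z -> one_modp p z' -> one_modp p (z * z').
Proof.
move=> [s sZ ->] [t tZ ->]; exists (s + t + p%:R * s * t); last by ring.
by rewrite !rpredD ?rpredM ?rpred_nat.
Qed.

Lemma one_modpV (p : nat) (z : rat) : (1 < p)%N -> one_modp p z -> one_modp p z^-1.
Proof.
move=> p_gt1 [s sZ ->]; have [n0 nZ] := Zloc_one_addV p_gt1 sZ.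
by exists (- (s * (1 + p%:R * s)^-1)); [rewrite rpredN rpredM | field].
Qed.

Lemma one_modp_twist (p : nat) (y : rat) (a b : nat) :
  prime p -> (b < p)%N -> y \in Zloc p -> one_modp p (twist p y a b).
Proof.
move=> pp bp yZ; have [eZ [r rZ ->]] := twist_log a pp bp yZ.
exists (- (y * harmonic a b) + p%:R * r); last by ring.
by rewrite rpredD // rpredM ?rpred_nat.
Qed.

(** Each numerator contains one multiple of [p], namely [p/6] or [p/2]. With [p] over the binomial
    coefficient taken out, the quotients are [2 z1] and [3 z2] with [z1], [z2] congruent to 1, and
    [2 * 2 - 3 = 1]. *)
Lemma cubic_sum_combination2 (p h : nat) : prime p -> (p = 6 * h + 5)%N ->
  exists2 r, r \in Zloc p &
    2%:R * (rising (5%:R / 6%:R) (2 * h + 1) /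
             (2%:R ^+ (2 * h + 1) * rising (2%:R / 3%:R) (2 * h + 1))) -
      rising (1 / 2%:R) (4 * h + 3) / (2%:R ^+ (4 * h + 3) * rising (1 / 3%:R) (4 * h + 3)) =
    p%:R / 'C(4 * h + 4, 2 * h + 2)%:R + p%:R ^+ 2 * r.
Proof.
move=> pp pE; have p_gt1 := prime_gt1 pp.
have b2 : (2 * h + 1 < p)%N by lia.
have b3 : (3 * h + 2 < p)%N by lia.
have b4 : (4 * h + 3 < p)%N by lia.
have b44 : (4 * h + 4 < p)%N by lia.
have bh : (h < p)%N by lia.
have b23 : (2 * h <= 3 * h + 2)%N by lia.
have b13 : (2 * h + 1 <= 3 * h + 2)%N by lia.
have b24 : (2 * h + 2 <= 4 * h + 4)%N by lia.
have d23 : (3 * h + 2 - 2 * h = h + 2)%N by lia.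
have d13 : (3 * h + 2 - (2 * h + 1) = h + 1)%N by lia.
have d56 : (2 * h + 1 = h + h.+1)%N by lia.
have d12 : (4 * h + 3 = 3 * h + 2 + h.+1)%N by lia.
have d4 : (4 * h + 4 = 2 * (2 * h + 2))%N by lia.
have d44 : (4 * h + 4 = 3 * h + 2 + (h + 2))%N by lia.
have d2 : (2 * (h + 1) = 2 * h + 2)%N by lia.
have d34 : (4 * h + 4 = (4 * h + 3).+1)%N by lia.
have d22 : (2 * h + 2 = (2 * h + 1).+1)%N by lia.
have d21 : (2 * h + 1 = (2 * h).+1)%N by lia.
have pm : p = (2 * (3 * h + 2)).+1 by lia.
have x2 : coprime p 2 by rewrite coprime_lt_prime //; lia.
have x3 : coprime p 3 by rewrite coprime_lt_prime //; lia.
have x6 : coprime p 6 by rewrite (coprimeMr p 2 3) x2.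
have pQ : p%:R = 6%:R * h%:R + 5%:R :> rat by rewrite pE natrD natrM.
have Z1 : 1 \in Zloc p := rpred1 _.
have Z2 : 1 / 2%:R \in Zloc p by rewrite div1r Zloc_natV.
have Z3 : 1 / 3%:R \in Zloc p by rewrite div1r Zloc_natV.
have Z6 : 1 / 6%:R \in Zloc p by rewrite div1r Zloc_natV.
have Z23 : 2%:R / 3%:R \in Zloc p by rewrite Zloc_ratio.
have tl y a b : (b < p)%N -> y \in Zloc p -> one_modp p (twist p y a b).
  by move=> bp yZ; apply: one_modp_twist.
have tn y a b : (b < p)%N -> y \in Zloc p -> twist p y a b != 0.
  by move=> bp yZ; have [] := log_modp2_unit p_gt1 (twist_log a pp bp yZ).
have W := pow4_twist pp pm.
have Wl : one_modp p (4%:R ^+ (3 * h + 2)).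
  by rewrite W; apply: one_modpM; [| apply: one_modpV => //]; apply: tl.
(* The product is cut around its middle factor [p/6]: below it are factors [p/6 - i], starting at
   [5/6 = p/6 - h], and above it [p/6 + i]. *)
have R56 : rising (5%:R / 6%:R) (2 * h + 1) =
    (-1) ^+ h * h`!%:R * twist p (1 / 6%:R) 0 h *
    (p%:R * (1 / 6%:R) * (h`!%:R * twist p (- (1 / 6%:R)) 0 h)).
  rewrite d56 rising_cat risingSl -rising_twist0 -rising_twistN.
  by congr (rising _ _ * (_ * rising _ _)); rewrite pQ; field.
have R23 : rising (2%:R / 3%:R) (2 * h + 1) =
    - ((2 * h + 1)`!%:R * twist p (1 / 3%:R) 0 (2 * h + 1)).
  have := rising_twist0 p (1 / 3%:R) (2 * h + 1).
  rewrite (_ : (-1) ^+ (2 * h + 1) = -1); last by rewrite -signr_odd oddD oddM.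
  by rewrite -[RHS]mulrA mulN1r => <-; congr rising; rewrite pQ natrD natrM; field.
(* Likewise around [p/2], starting from [1/2 = p/2 - (3h + 2)]. *)
have R12 : rising (1 / 2%:R) (4 * h + 3) =
    (-1) ^+ h * (3 * h + 2)`!%:R * twist p (1 / 2%:R) 0 (3 * h + 2) *
    (p%:R * (1 / 2%:R) * (h`!%:R * twist p (- (1 / 2%:R)) 0 h)).
  rewrite d12 rising_cat risingSl -rising_twistN.
  have <- : (-1) ^+ (3 * h + 2) = (-1) ^+ h :> rat.
    by rewrite -[LHS]signr_odd -[RHS]signr_odd oddD oddM addbF.
  rewrite -rising_twist0.
  by congr (rising _ _ * (_ * rising _ _)); rewrite pQ natrD natrM; field.
have R13 : rising (1 / 3%:R) (4 * h + 3) =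
    - ((4 * h + 3)`!%:R * twist p (2%:R / 3%:R) 0 (4 * h + 3)).
  have := rising_twist0 p (2%:R / 3%:R) (4 * h + 3).
  rewrite (_ : (-1) ^+ (4 * h + 3) = -1); last by rewrite -signr_odd oddD oddM.
  by rewrite -[RHS]mulrA mulN1r => <-; congr rising; rewrite pQ natrD natrM; field.
have F4 : (4 * h + 4)`!%:R / (3 * h + 2)`!%:R =
    (-1) ^+ h * ((3 * h + 2)`!%:R / (2 * h)`!%:R) * twist p 1 (2 * h) (3 * h + 2).
  rewrite {1}d44 -rising_fact; have := rising_twist p 1 b23.
  rewrite d23 exprD sqrrN expr1n [_ ^+ h * 1]mulr1 => <-.
  by congr rising; rewrite pQ natrD natrM; ring.
have F3 : (2 * h + 2)`!%:R = 4%:R ^+ h * 4%:R * ((h%:R + 1) * h`!%:R) *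
    (- (-1) ^+ h * ((3 * h + 2)`!%:R / (2 * h + 1)`!%:R) *
     twist p (1 / 2%:R) (2 * h + 1) (3 * h + 2)).
  have fh : (h + 1)`!%:R = (h%:R + 1) * h`!%:R :> rat by rewrite addn1 factS natrM -natr1.
  rewrite -d2 fact_double fh exprD expr1.
  have := rising_twist p (1 / 2%:R) b13.
  rewrite d13 exprD expr1 mulrN1 => <-; congr (_ * rising _ _).
  by rewrite pQ natrD natrM; field.
have C4 := central_bin (2 * h + 2); rewrite -d4 in C4.
have F44 : (4 * h + 4)`!%:R = (4%:R * h%:R + 4%:R) * (4 * h + 3)`!%:R :> rat.
  by rewrite {1}d34 factS natrM -d34 natrD natrM.
have F22 : (2 * h + 2)`!%:R = (2%:R * h%:R + 2%:R) * (2 * h + 1)`!%:R :> rat.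
  by rewrite {1}d22 factS natrM -d22 natrD natrM.
have F21 : (2 * h + 1)`!%:R = (2%:R * h%:R + 1) * (2 * h)`!%:R :> rat.
  by rewrite {1}d21 factS natrM -d21 natrD natrM.
have Q0 : 4%:R ^+ h != 0 :> rat by rewrite expf_neq0.
have e21 : 2%:R ^+ (2 * h + 1) = 4%:R ^+ h * 2%:R :> rat by rewrite exprD exprM -natrX.
have e43 : 2%:R ^+ (4 * h + 3) = 4%:R ^+ h ^+ 2 * 8%:R :> rat.
  rewrite (_ : 4 * h + 3 = 2 * (h * 2) + 3)%N; last by lia.
  by rewrite exprD exprM exprM; congr (_ ^+ _ ^+ _ * _).
have e32 : 4%:R ^+ (3 * h + 2) = 4%:R ^+ h ^+ 3 * 16%:R :> rat.
  by rewrite exprD [(3 * h)%N]mulnC exprM; congr (_ ^+ _ * _).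
(* The factorials leave linear factors in [h]; [1 + p = 6 (h + 1)] and [1 - p/2 = - 3 (2h + 1)/2]
   trade them for numbers congruent to 1. *)
have ol : one_modp p (1 + p%:R * 1) by exists 1.
pose w := (4%:R ^+ (3 * h + 2))^-1 * (1 + p%:R * 1)^-1 : rat.
have wl : one_modp p w by apply: one_modpM; apply: one_modpV.
pose z1 := w * ((1 + p%:R * 1)^-1 * ((1 + p%:R * (- (1 / 2%:R))) *
  (twist p 1 (2 * h) (3 * h + 2) * (twist p (1 / 6%:R) 0 h * (twist p (- (1 / 6%:R)) 0 h *
   ((twist p (1 / 2%:R) (2 * h + 1) (3 * h + 2))^-1 *
    ((twist p (1 / 2%:R) (2 * h + 1) (3 * h + 2))^-1 *
     (twist p (1 / 3%:R) 0 (2 * h + 1))^-1))))))).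
pose z2 := w * (twist p (1 / 2%:R) 0 (3 * h + 2) * (twist p (- (1 / 2%:R)) 0 h *
  ((twist p (1 / 2%:R) (2 * h + 1) (3 * h + 2))^-1 *
   (twist p (2%:R / 3%:R) 0 (4 * h + 3))^-1))).
have z1l : one_modp p z1.
  apply: one_modpM => //; apply: one_modpM; first exact: one_modpV.
  apply: one_modpM; first by exists (- (1 / 2%:R)); rewrite ?rpredN.
  by do 3! (apply: one_modpM; first by apply: tl; rewrite ?rpredN);
    do 2! (apply: one_modpM; first by apply: one_modpV => //; apply: tl);
    apply: one_modpV => //; apply: tl.
have z2l : one_modp p z2.
  apply: one_modpM => //.
  by do 2! (apply: one_modpM; first by apply: tl; rewrite ?rpredN);
    apply: one_modpM; apply: one_modpV => //; apply: tl.
have CZ : 'C(4 * h + 4, 2 * h + 2)%:R^-1 \in Zloc p.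
  apply: Zloc_natV; apply: (coprime_dvdr _ (coprime_fact pp b44)).
  by rewrite -(bin_fact b24) dvdn_mulr.
have x0 : 0 <= h%:R :> rat by [].
have y1 : h%:R + 1 != 0 :> rat by apply: lt0r_neq0; lra.
have y2 : 2%:R * h%:R + 2%:R != 0 :> rat by apply: lt0r_neq0; lra.
have y4 : 4%:R * h%:R + 4%:R != 0 :> rat by apply: lt0r_neq0; lra.
have y6 : 1 + (6%:R * h%:R + 5%:R) * 1 != 0 :> rat by apply: lt0r_neq0; lra.
have y21 : 2%:R * h%:R + 1 != 0 :> rat by apply: lt0r_neq0; lra.
have t0 := tn _ (2 * h + 1)%N _ b3 Z2; have t1 := tn _ 0 _ b2 Z3.
have t2 := tn _ 0 _ b4 Z23; have t3 := tn _ (2 * h)%N _ b3 Z1.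
have f1 := fact_neq0 h; have f2 := fact_neq0 (2 * h); have f3 := fact_neq0 (3 * h + 2).
have fM := fact_neq0 (2 * h + 1).
have F43 : (4 * h + 3)`!%:R = (3 * h + 2)`!%:R * ((-1) ^+ h * ((3 * h + 2)`!%:R / (2 * h)`!%:R) *
    twist p 1 (2 * h) (3 * h + 2)) / (4%:R * h%:R + 4%:R).
  by rewrite -F4 F44; move: ((3 * h + 2)`!%:R) f3 => g g0; field; rewrite g0 y4.
(* [F3] solved for [(3h + 2)!], which can then be eliminated from both quotients. *)
have G : (3 * h + 2)`!%:R = - (-1) ^+ h * (2 * h + 1)`!%:R ^+ 2 /
    (2%:R * 4%:R ^+ h * h`!%:R * twist p (1 / 2%:R) (2 * h + 1) (3 * h + 2)).
  rewrite F22 in F3; move: (twist p _ _ _) t0 F3 => P P0 F3.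
  move: ((2 * h + 1)`!%:R) ((3 * h + 2)`!%:R) (h`!%:R) (4%:R ^+ h) fM f3 f1 Q0 F3.
  move=> M g f Q M0 g0 f0 Q0 F3.
  have ME := mulKf y2 M; rewrite F3 in ME.
  by rewrite expr2 -{1}ME; case: (sign_cases h) => ->; field; rewrite ?M0 ?f0 ?Q0 ?P0 ?y2.
have E1 : rising (5%:R / 6%:R) (2 * h + 1) /
      (2%:R ^+ (2 * h + 1) * rising (2%:R / 3%:R) (2 * h + 1)) =
    p%:R / 'C(4 * h + 4, 2 * h + 2)%:R * (2%:R * z1).
  rewrite /z1 /w R56 R23 C4 F44 F43 G F22 F21 e21 e32.
  rewrite {W Wl R56 R23 R12 R13 C4 F44 F43 G F4 F22 F21 F3 e21 e32 e43 tl tn wl ol z1l z2l z1 z2 w}.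
  move: f1 f2 x0 y1 y2 y4 y6 y21 Q0 t0 t1 t3; rewrite pQ.
  move: (twist p _ _ _) (twist p _ _ _) (twist p _ _ _) (twist p _ _ _) (twist p _ _ _).
  move: (4%:R ^+ h) (h`!%:R) ((2 * h)`!%:R) (h%:R) (sign_cases h).
  move=> Q f g x [] -> T1 T2 T3 T4 T5 f0 g0 x0 y1 y2 y4 y6 y21 Q0 t5 t4 t3;
    field; rewrite ?f0 ?g0 ?Q0 ?t3 ?t4 ?t5 ?y1 ?y2 ?y4 ?y6 ?y21 /=;
    by repeat (apply/andP; split); first [done | apply: lt0r_neq0; lra].
have E2 : rising (1 / 2%:R) (4 * h + 3) / (2%:R ^+ (4 * h + 3) * rising (1 / 3%:R) (4 * h + 3)) =
    p%:R / 'C(4 * h + 4, 2 * h + 2)%:R * (3%:R * z2).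
  have f43 := fact_neq0 (4 * h + 3).
  rewrite /z2 /w R12 R13 C4 F44 F22 G e43 e32.
  rewrite {W Wl R56 R23 R12 R13 C4 F44 F43 G F4 F22 F21 F3 e21 e32 e43 tl tn wl ol z1l z2l z1 z2 w
    E1}.
  move: f1 fM f43 x0 y1 y2 y4 y6 Q0 t0 t2; rewrite pQ {t1 t3}.
  move: (twist p _ _ _) (twist p _ _ _) (twist p _ _ _) (twist p _ _ _).
  move: (4%:R ^+ h) (h`!%:R) ((2 * h + 1)`!%:R) ((4 * h + 3)`!%:R) (h%:R) (sign_cases h).
  move=> Q f g k x [] -> T1 T2 T3 T4 f0 g0 k0 x0 y1 y2 y4 y6 Q0 t4 t3;
    field; rewrite ?f0 ?g0 ?k0 ?Q0 ?t3 ?t4 ?y1 ?y2 ?y4 ?y6 /=;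
    by repeat (apply/andP; split); first [done | apply: lt0r_neq0; lra].
rewrite E1 E2; case: z1l => s sZ ->; case: z2l => t tZ ->.
exists ('C(4 * h + 4, 2 * h + 2)%:R^-1 * (4%:R * s - 3%:R * t)); last by ring.
by rewrite rpredM // rpredB // rpredM ?rpred_nat.
Qed.

(** * Specialization to [u = 0, 1, 2] in the two residue classes *)

Theorem theorem1p2 (p : nat) (p_prime : prime p) (p_gt3 : (3 < p)%N) :
  let S : rat := \sum_(0 <= k < p) ('C(2 * k, k)%:R * 'C(3 * k, k)%:R) / 24%:R ^+ k in
  ((p = 1 %[mod 3])%N ->
     eqmod_Zloc p (p ^ 2) S ('C((2 * p - 2) %/ 3, (p - 1) %/ 3)%:R)) /\
  ((p = 2 %[mod 3])%N ->
     eqmod_Zloc p (p ^ 2) S (p%:R / 'C((2 * p + 2) %/ 3, (p + 1) %/ 3)%:R)).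
Proof.
have p_odd : odd p by case: (even_prime p_prime) => // e; rewrite e in p_gt3.
(* Oddness of [p] refines the residue modulo 3 to one modulo 6. *)
have mod1 : (p = 1 %[mod 3])%N -> exists h, [/\ p = 6 * h + 1, (2 * p - 2) %/ 3 = 4 * h,
    (p - 1) %/ 3 = 2 * h & [/\ 2 * h < p, 4 * h < p & 0 < 2 * h]]%N.
  by move=> p3; exists (p %/ 6)%N; repeat split; lia.
have mod2 : (p = 2 %[mod 3])%N -> exists h, [/\ p = 6 * h + 5,
    (2 * p + 2) %/ 3 = 4 * h + 4, (p + 1) %/ 3 = 2 * h + 2 &
    [/\ 2 * h + 1 < p, 4 * h + 3 < p, 4 * h + 4 < p & 2 * h + 2 <= 4 * h + 4]]%N.
  by move=> p3; exists (p %/ 6)%N; repeat split; lia.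
move=> S.
have [S0 [r rZ SE]] := cubic_sum_modp2 p_prime p_gt3.
have {S0 SE} [SZ SE] : S \in Zloc p /\
    S = 2%:R * \sum_(0 <= k < p) cubic_term ((p%:R * 1 - 1) / 3%:R) k -
        \sum_(0 <= k < p) cubic_term ((p%:R * 2%:R - 1) / 3%:R) k + p%:R ^+ 2 * r.
  (* At [u = 0] the parameter is [x = - 1/3], the undeformed series. *)
  have -> : S = \sum_(0 <= k < p) cubic_term ((p%:R * 0%:R - 1) / 3%:R) k.
    apply: eq_bigr => k _; rewrite -cubic_term_bin; congr cubic_term.
    by rewrite mulr0 sub0r mulNr.
  by [].
have main (C : rat) : C \in Zloc p ->
    (exists2 s, s \in Zloc p & 2%:R * \sum_(0 <= k < p) cubic_term ((p%:R * 1 - 1) / 3%:R) k -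
        \sum_(0 <= k < p) cubic_term ((p%:R * 2%:R - 1) / 3%:R) k = C + p%:R ^+ 2 * s) ->
    eqmod_Zloc p (p ^ 2) S C.
  move=> CZ [s sZ E]; split=> //; exists (s + r); first exact: rpredD.
  by rewrite SE E natrX; ring.
split=> [/mod1 [h [pE -> -> [b2 b4 h_gt0]]] | /mod2 [h [pE -> -> [b2 b3 b4 b24]]]].
- apply: main; first exact: rpred_nat.
  have pQ : p%:R = 6%:R * h%:R + 1 :> rat by rewrite pE natrD natrM.
  (* Here [u = 1] gives an integer [x], and [u = 2] an integer plus 1/3. *)
  rewrite (_ : (p%:R * 1 - 1) / 3%:R = (2 * h)%:R); last by rewrite pQ natrM; field.
  rewrite (_ : (p%:R * 2%:R - 1) / 3%:R = (4 * h)%:R + 1 / 3%:R); last first.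
    by rewrite pQ natrM; field.
  by rewrite cubic_sum1 // cubic_sum2 //; apply: cubic_sum_combination1.
apply: main.
  rewrite rpredM ?rpred_nat // Zloc_natV //.
  apply: (coprime_dvdr _ (coprime_fact p_prime b4)).
  by rewrite -(bin_fact b24) dvdn_mulr.
have pQ : p%:R = 6%:R * h%:R + 5%:R :> rat by rewrite pE natrD natrM.
(* The two kinds of termination are exchanged with respect to the previous case. *)
rewrite (_ : (p%:R * 1 - 1) / 3%:R = (2 * h + 1)%:R + 1 / 3%:R); last first.
  by rewrite pQ natrD natrM; field.
rewrite (_ : (p%:R * 2%:R - 1) / 3%:R = (4 * h + 3)%:R); last first.
  by rewrite pQ natrD natrM; field.
have n0 : (0 < 4 * h + 3)%N by rewrite addn3.
by rewrite cubic_sum2 // cubic_sum1 //; apply: cubic_sum_combination2.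
Qed.
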